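(* Let $\kappa$ be an infinite cardinal number, $X$ a set and $\mathcal F$ a family of functions from $X$ to $[0,1]$. Then: (a) $\mathcal F$ induces a $\kappa$-exhaustion of $X$ if and only if there exists $\mathcal G\subset\mathrm{Int}(\mathcal F)$ of cardinality $\le\kappa$ such that, for every $x\in X$, $$\sup_{g\in\mathcal G}g(x)=0\quad\text{implies}\quad\sup_{f\in\mathcal F}f(x)=0;$$ (b) $\mathcal F$ induces a residual $\kappa$-exhaustion of $X$ if and only if there exists $\mathcal G\subset\mathrm{Int}(\mathcal F)$ of cardinality $\le\kappa$ such that, for every net $(x_d)_{d\in D}$ in $X$, $$\sup_{g\in\mathcal G}\lim_d g(x_d)=0\quad\text{implies}\quad\sup_{f\in\mathcal F}\lim_d f(x_d)=0.$$
   Context: All underlying sets on which functions or probabilities are considered are non-empty. For $U\subset X$, $\Delta(U)$ is the set of functions $h:X\to\mathbb R_+$ with finite support contained in $U$ and $\sum_{x}h(x)=1$. For $f\in\mathbb R^X$ and $h$ of finite support, $[f,h]=\sum_{x\in X}f(x)h(x)$. Define $$I_{\mathcal F}(U)=\inf_{h\in\Delta(U)}\ \sup_{f\in\mathcal F}\,[\,|f|\wedge1,\,h\,],\qquad U\subset X.$$ A family $\{X_\alpha:\alpha\in\mathfrak A\}$ of subsets of $X$ is a $\kappa$-exhaustion (of $X$) induced by $\mathcal F$ if: (i) $\mathfrak A$ has cardinality $\le\kappa$; (ii) $I_{\mathcal F}(X_\alpha)>0$ for every $\alpha\in\mathfrak A$; (iii) $\sup_{(x,f)\in X_0\times\mathcal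 F}|f(x)|=0$, where $X_0=X\setminus\bigcup_{\alpha\in\mathfrak A}X_\alpha$ (this being vacuously true if $X_0=\emptyset$). A residual $\kappa$-exhaustion is defined by replacing (iii) with: (iii') $\lim_df(x_d)=0$ (for every $f\in\mathcal F$) for each net $(x_d)_{d\in D}$ in $X$ which is eventually in $\bigcap_{i=1}^nX_{\alpha_i}^c$ for every $\alpha_1,\dots,\alpha_n\in\mathfrak A$. $\mathrm{Int}(\mathcal F)$, the integral hull of $\mathcal F$, is the set of all functions $x\mapsto\int_{\mathcal F}f(x)\,m(df)$ on $X$, where $m$ ranges over the finitely additive probabilities on the power set of $\mathcal F$ for which each evaluation $f\mapsto f(x)$, $x\in X$, is $m$-integrable (Dunford–Schwartz integral). In (b), ''$\sup_{g\in\mathcal G}\lim_dg(x_d)=0$'' means that $\lim_dg(x_d)$ exists and equals $0$ for every $g\in\mathcal G$, and similarly for $\mathcal F$ (all functions involved are non-negative). *)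

(* Defs.v *)
From HB Require Import structures.
From mathcomp Require Import all_boot all_order all_algebra.
From mathcomp Require Import all_classical all_reals all_analysis.

Set Implicit Arguments.
Unset Strict Implicit.
Unset Printing Implicit Defensive.

Import Order.TTheory GRing.Theory Num.Theory.
Import numFieldNormedType.Exports.

Local Open Scope classical_set_scope.
Local Open Scope ring_scope.

(* Supremum of a set of non-negative reals, taken in [0, +oo]: adjoining 0
   only matters for the empty set, whose supremum is then 0 (and not -oo). *)
Definition nnsup (R : realType) (A : set R) : \bar R :=
  ereal_sup (EFin @` (0 |` A)).

Definition Delta (R : realType) (X : choiceType) (U : set X) : set (X -> R) :=
  [set h | [/\ forall x, 0 <= h x,
               finite_set [set x | h x != 0],
               [set x | h x != 0] `<=` U &
               \sum_(x \in [set: X]) h x = 1]].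

(* Only meaningful when h has finite support: the finitely supported sum is 0
   by default otherwise. *)
Definition bracket (R : realType) (X : choiceType) (f h : X -> R) : R :=
  \sum_(x \in [set: X]) f x * h x.

(* The infimum is taken in \bar R, so that I_of F set0 = +oo. *)
Definition I_of (R : realType) (X : choiceType) (F : set (X -> R))
    (U : set X) : \bar R :=
  ereal_inf [set nnsup [set bracket (fun x => Num.min `|f x| 1) h | f in F]
            | h in @Delta R X U].

Definition is_directed (D : Type) (le : D -> D -> Prop) : Prop :=
  [/\ [set: D] !=set0,
      forall a, le a a,
      forall a b c, le a b -> le b c -> le a c &
      forall a b, exists c, le a c /\ le b c].

(* A property holds eventually along a net indexed by (D, le) iff the set of
   indices where it holds belongs to this filter; a net of reals u converges
   to l iff [u d @[d --> tails le] --> l]. *)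
Definition tails (D : Type) (le : D -> D -> Prop) : set_system D :=
  [set A | exists d0, forall d, le d0 d -> A d].

(* A cardinal number is represented by a type K of that cardinality. *)
Definition is_exhaustion (R : realType) (K : Type) (X : choiceType)
    (F : set (X -> R)) (A : Type) (Xs : A -> set X) : Prop :=
  [/\ ([set: A] #<= [set: K])%card,
      forall a, (0 < I_of F (Xs a))%E &
      nnsup [set `|f x| | x in ~` (\bigcup_(a in [set: A]) Xs a) & f in F]
        = 0%E].

Definition is_residual_exhaustion (R : realType) (K : Type) (X : choiceType)
    (F : set (X -> R)) (A : Type) (Xs : A -> set X) : Prop :=
  [/\ ([set: A] #<= [set: K])%card,
      forall a, (0 < I_of F (Xs a))%E &
      forall (D : Type) (le : D -> D -> Prop) (x : D -> X), is_directed le ->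
        (forall (n : nat) (al : 'I_n -> A),
           \forall d \near tails le,
             (\bigcap_(i in [set: 'I_n]) ~` Xs (al i)) (x d)) ->
        forall f, F f -> f (x d) @[d --> tails le] --> (0 : R)].

Definition induces_exhaustion (R : realType) (K : Type) (X : choiceType)
    (F : set (X -> R)) : Prop :=
  exists (A : Type) (Xs : A -> set X), is_exhaustion K F Xs.

Definition induces_residual_exhaustion (R : realType) (K : Type)
    (X : choiceType) (F : set (X -> R)) : Prop :=
  exists (A : Type) (Xs : A -> set X), is_residual_exhaustion K F Xs.

Definition finadd_probability (R : realType) (T : Type) (m : set T -> R)
    : Prop :=
  [/\ forall A, 0 <= m A,
      m [set: T] = 1 &
      forall A B, A `&` B = set0 -> m (A `|` B) = m A + m B].

(* phi is m-integrable in the sense of Dunford and Schwartz, with integral v: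
   there are simple functions converging to phi in m-measure, Cauchy in mean,
   and whose integrals tend to v.  Every subset of T is m-measurable here, so
   a simple function is just a function with finite image, and m is its own
   outer measure. *)
Definition DS_integral (R : realType) (T : Type) (m : set T -> R)
    (phi : T -> R) (v : R) : Prop :=
  exists s : nat -> {fimfun T >-> R},
    [/\ forall e : R, 0 < e ->
          m [set w | e < `|s n w - phi w|] @[n --> \oo] --> (0 : R),
        sintegral (EFin \o m) (fun w => `|s p.1 w - s p.2 w|)
          @[p --> (\oo, \oo)] --> 0%E &
        sintegral (EFin \o m) (s n) @[n --> \oo] --> v%:E].

(* The sample space is the subtype of the members of F, so that m ranges over
   probabilities on the power set of F. *)
Definition Int (R : realType) (X : choiceType) (F : set (X -> R))
    : set (X -> R) :=
  [set g | exists m : set (set_type F) -> R, finadd_probability m /\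
     forall x, DS_integral m (fun f : set_type F => \val f x) (g x)].

(* Main.v *)
Require Import Defs.
From HB Require Import structures.
From mathcomp Require Import all_boot all_order all_algebra.
From mathcomp Require Import all_classical all_reals all_analysis.
From mathcomp Require Import finmap lra.
Import Order.TTheory GRing.Theory Num.Theory.
Import numFieldNormedType.Exports.
Local Open Scope classical_set_scope.
Local Open Scope ring_scope.

(* The key fact is that I_F(U) > 0 iff some g in Int(F) is bounded below on U by
   a constant c > 0.  If h is in Delta(U) and g(x) is the integral of f(x)
   against m, then c <= [g, h] is an m-average over f of [f, h], hence is at
   most sup_f [f, h].  Conversely, let c = I_F(U) > 0; the sublinear functional
     p(phi) = inf_h (sup_f (phi(f) + [f, h]) - c |h|)
   on the bounded functions on F, with h ranging over the cone of non-negative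
   finitely supported functions on U, dominates by Hahn-Banach a linear
   functional, which is integration against a finitely additive probability m,
   and the m-integral of f(x) is then at least c for every x in U.
   Hence an exhaustion (X_a) yields one g_a >= c_a on each X_a; conversely, G
   yields the exhaustion by the sets {g >= 1/(n+1)} for g in G and n in nat,
   which are at most kappa many because kappa is infinite. *)

Set Implicit Arguments.
Unset Strict Implicit.
Unset Printing Implicit Defensive.

(** * Infima of sets of reals and sublinear functionals *)

Lemma inf_le_add (R : realType) (A B C : set R) :
  has_lbound A -> B !=set0 -> C !=set0 ->
  (forall b c, B b -> C c -> exists2 a, A a & a <= b + c) ->
  inf A <= inf B + inf C.
Proof.
move=> lA B0 C0 H; rewrite -lerBlDr; apply: lb_le_inf => // b Bb.
rewrite lerBlDr addrC -lerBlDr; apply: lb_le_inf => // c Cc.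
have [a Aa ab] := H _ _ Bb Cc.
by rewrite lerBlDr (le_trans (ge_inf lA Aa))// addrC.
Qed.

Lemma inf_le_scale (R : realType) (A B : set R) (k : R) :
  0 < k -> has_lbound A -> B !=set0 ->
  (forall b, B b -> exists2 a, A a & a <= k * b) ->
  inf A <= k * inf B.
Proof.
move=> k0 lA B0 H; rewrite -ler_pdivrMl//; apply: lb_le_inf => // b Bb.
have [a Aa ab] := H _ Bb.
by rewrite ler_pdivrMl// (le_trans (ge_inf lA Aa)).
Qed.

Definition sublinear (R : realType) (V : lmodType R) (p : V -> R) : Prop :=
  (forall x y, p (x + y) <= p x + p y) /\
  (forall c x, 0 <= c -> p (c *: x) = c * p x).

(** The converse inequality for a positive [c] is the assumed one for [c^-1] at [c *: x]; the case
    [c = 0] is [p 0 = 0]. *)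
Lemma sublinearP (R : realType) (V : lmodType R) (p : V -> R) :
  (forall x y, p (x + y) <= p x + p y) -> p 0 = 0 ->
  (forall c x, 0 < c -> p (c *: x) <= c * p x) -> sublinear p.
Proof.
move=> pD p0 pZ; split=> // c x; rewrite le_eqVlt => /predU1P[<-|c0].
  by rewrite scale0r mul0r p0.
apply/eqP; rewrite eq_le pZ//= -ler_pdivlMl//.
have := pZ c^-1 (c *: x); rewrite invr_gt0 => /(_ c0).
by rewrite scalerA mulVf ?gt_eqF// scale1r.
Qed.

Section sublinear_theory.
Context (R : realType) (V : lmodType R) (p : V -> R).
Hypothesis p_sub : sublinear p.

Lemma sublinear0 : p 0 = 0.
Proof. by case: p_sub => _ /(_ 0 0 (lexx _)); rewrite scale0r mul0r. Qed.

Lemma sublinear_geN x : - p (- x) <= p x.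
Proof.
case: p_sub => /(_ x (- x)) + _.
by rewrite subrr sublinear0 -lerBlDr sub0r.
Qed.

Lemma sublinear_leB x y : p x - p y <= p (x - y).
Proof.
by case: p_sub => /(_ (x - y) y) + _; rewrite subrK lerBlDr.
Qed.

End sublinear_theory.

(** * Hahn-Banach: linear functionals below a sublinear one, by Zorn's lemma *)

Section linear_minorant.
Context (R : realType) (V : lmodType R).

Let minorant (p : V -> R) := {q : V -> R | sublinear q /\ forall x, q x <= p x}.
(** The pointwise order is reversed because [ZL_preorder] yields maximal elements. *)
Let below (p : V -> R) (s t : minorant p) := `[< forall x, sval t x <= sval s x >].

(** By Zorn's lemma: a non-empty chain of sublinear minorants is bounded by its pointwise infimum,
    which is finite because every minorant [q] satisfies [- p (- x) <= - q (- x) <= q x]. *)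
Lemma minimal_minorant (p : V -> R) : sublinear p ->
  exists q : V -> R, [/\ sublinear q, forall x, q x <= p x &
    forall q', sublinear q' -> (forall x, q' x <= q x) ->
      forall x, q x <= q' x].
Proof.
move=> psub; pose p0 : minorant p := exist _ p (conj psub (fun=> lexx _)).
have [||A totA|[q [qsub qp]] qmin] := ZL_preorder p0 (R := @below p).
- by move=> s; apply/asboolP.
- by move=> s r t /asboolP rs /asboolP st; apply/asboolP => x; exact: le_trans (rs x).
(* The empty chain is set apart, [inf] of the empty set being a mere default value; [p] itself
   bounds it. *)
- have [[s0 As0]|A0] := pselect (A !=set0); last first.
    by exists p0 => s As; exfalso; apply: A0; exists s.
  pose E x := [set sval s x | s in A].
  have E0 x : E x !=set0 by exists (sval s0 x); exists s0.
  have lE x : has_lbound (E x).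
    exists (- p (- x)) => _ [[q [qs qp]] Aq <-] /=.
    by rewrite (le_trans _ (sublinear_geN qs x))// lerN2.
  have qsub : sublinear (fun x => inf (E x)).
    apply: sublinearP.
    + move=> x y; apply: inf_le_add => // _ _ [s As <-] [t At <-].
      (* The smaller of [s] and [t] serves at both points; this is where totality of the chain
         enters. *)
      have [/asboolP st|/asboolP ts] := totA _ _ As At.
        exists (sval t (x + y)); first by exists t.
        by case: (svalP t) => -[tD _] _; rewrite (le_trans (tD x y))// lerD2r.
      exists (sval s (x + y)); first by exists s.
      by case: (svalP s) => -[sD _] _; rewrite (le_trans (sD x y))// lerD2l.
    + rewrite (_ : E 0 = [set 0]) ?inf1//; apply/seteqP; split=> [_ [s As <-]|_ ->].
        by case: (svalP s) => ss _; rewrite (sublinear0 ss).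
      by exists s0 => //; case: (svalP s0) => ss _; rewrite (sublinear0 ss).
    + move=> c x c0; apply: inf_le_scale => // _ [s As <-].
      exists (sval s (c *: x)); first by exists s.
      by case: (svalP s) => -[_ sZ] _; rewrite sZ// ltW.
  have qp x : inf (E x) <= p x.
    have Esx : E x (sval s0 x) by exists s0.
    by rewrite (le_trans (ge_inf (lE x) Esx))//; case: (svalP s0).
  pose t : minorant p := exist _ (fun x => inf (E x)) (conj qsub qp).
  exists t => s As; apply/asboolP => x /=.
  by apply: ge_inf => //; exists s.
exists q; split=> // q' q'sub q'q x.
have q'p y : q' y <= p y by exact: le_trans (qp y).
pose t : minorant p := exist _ q' (conj q'sub q'p).
have /(_ _)/asboolP := qmin t.
by apply; apply/asboolP.
Qed.

(* Minimality of q forces linearity: for every v, the sublinear function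
   x |-> inf_(t >= 0) (q (x + t v) - t q v) lies below q, hence equals q, which
   at t = 1 gives q x + q v <= q (x + v). *)
Lemma linear_minorant (p : V -> R) : sublinear p ->
  exists L : V -> R, [/\ forall x y, L (x + y) = L x + L y,
    forall c x, L (c *: x) = c * L x & forall x, L x <= p x].
Proof.
move=> /minimal_minorant[q [qsub qp qmin]]; have [qD qZ] := qsub.
have q0 : q 0 = 0 := sublinear0 qsub.
have qadd x v : q (x + v) = q x + q v.
  apply/eqP; rewrite eq_le qD/= -lerBrDr.
  pose E x := [set q (x + t *: v) - t * q v | t in [set t | 0 <= t]].
  have E0 z : E z !=set0 by exists (q (z + 0 *: v) - 0 * q v); exists 0 => /=.
  (* Subadditivity gives [q (s v) <= q (z + s v) + q (- z)], so the set is bounded below and its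
     infimum is genuine. *)
  have Eq z t : E z t -> - q (- z) <= t.
    move=> [s s0 <-]; rewrite -qZ// lerBrDr addrC.
    have := sublinear_leB qsub (s *: v) (- z).
    by rewrite opprK [z + _]addrC.
  have lE z : has_lbound (E z) by exists (- q (- z)) => t /Eq.
  have /(_ _ _ x) := qmin (fun z => inf (E z)); move=> /(_ _ _)/le_trans; apply.
  - apply: sublinearP.
    + move=> y z; apply: inf_le_add => // _ _ [s s0 <-] [t t0 <-].
      exists (q (y + z + (s + t) *: v) - (s + t) * q v).
        by exists (s + t) => //=; exact: addr_ge0.
      rewrite mulrDl opprD addrACA lerD2r scalerDl addrACA; exact: qD.
    + apply/eqP; rewrite eq_le; apply/andP; split.
        by apply: ge_inf => //; exists 0 => //=; rewrite scale0r addr0 q0 mul0r subr0.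
      by apply: lb_le_inf => // t /Eq; rewrite oppr0 q0 oppr0.
    + move=> c z c0; apply: inf_le_scale => // _ [s s0 <-].
      exists (q (c *: z + (c * s) *: v) - (c * s) * q v).
        by exists (c * s) => //=; rewrite mulr_ge0// ltW.
      by rewrite -scalerA -scalerDr qZ ?(ltW c0)// -mulrA -mulrBr.
  - by move=> z; apply: ge_inf => //; exists 0 => //=; rewrite scale0r addr0 mul0r subr0.
  - by apply: ge_inf => //; exists 1 => //=; rewrite scale1r mul1r.
have qN x : q (- x) = - q x.
  by apply/eqP; rewrite -addr_eq0 -qadd addNr q0.
exists q; split=> // c x; have [c0|/ltW c0] := leP 0 c; first exact: qZ.
by rewrite -[c]opprK scaleNr qN qZ ?oppr_ge0 // !mulNr.
Qed.

(** Hahn-Banach is applied to the infimum of [p (x + w)] over conic combinations [w] of [W]. The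
    hypothesis [0 <= p w] bounds it below by [- p (- x)], and [w = 0] places it below [p]. At
    [x = - v], the choice [w = v] gives [L (- v) <= 0]. *)
Lemma linear_minorant_ge0 (p : V -> R) (W : set V) : sublinear p ->
  (forall l : seq (R * V), (forall i, i \in l -> 0 <= i.1 /\ W i.2) ->
    0 <= p (\sum_(i <- l) i.1 *: i.2)) ->
  exists L : V -> R, [/\ forall x y, L (x + y) = L x + L y,
    forall c x, L (c *: x) = c * L x, forall x, L x <= p x &
    forall v, W v -> 0 <= L v].
Proof.
move=> psub pW; have [pD pZ] := psub.
pose conic (l : seq (R * V)) := forall i, i \in l -> 0 <= i.1 /\ W i.2.
pose E x := [set p (x + \sum_(i <- l) i.1 *: i.2) | l in conic].
have conic0 : conic [::] by [].
have E0 x : E x !=set0 by eexists; exists [::].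
have Ep x t : E x t -> - p (- x) <= t.
  move=> [l /pW l0 <-].
  have := pD (x + \sum_(i <- l) i.1 *: i.2) (- x).
  by rewrite addrAC subrr add0r => /(le_trans l0); rewrite -lerBlDr sub0r.
have lE x : has_lbound (E x) by exists (- p (- x)) => t /Ep.
have Elex x : inf (E x) <= p x.
  by apply: ge_inf => //; exists [::] => //; rewrite big_nil addr0.
have [|L [LD LZ LE]] := @linear_minorant (fun x => inf (E x)).
  apply: sublinearP.
  - move=> x y; apply: inf_le_add => // _ _ [l cl <-] [l' cl' <-].
    exists (p (x + y + \sum_(i <- l ++ l') i.1 *: i.2)).
      by exists (l ++ l') => // i; rewrite mem_cat => /orP[/cl|/cl'].
    by rewrite big_cat addrACA; exact: pD.
  - apply/eqP; rewrite eq_le (le_trans (Elex 0)) ?(sublinear0 psub)//=.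
    by apply: lb_le_inf => // t /Ep; rewrite oppr0 (sublinear0 psub) oppr0.
  - move=> c x c0; apply: inf_le_scale => // _ [l cl <-].
    exists (p (c *: x + \sum_(i <- [seq (c * i.1, i.2) | i <- l]) i.1 *: i.2)).
      exists [seq (c * i.1, i.2) | i <- l] => // i /mapP[j /cl[j0 Wj] ->] /=.
      by split=> //; rewrite mulr_ge0// ltW.
    rewrite big_map/=; under eq_bigr do rewrite -scalerA.
    by rewrite -scaler_sumr -scalerDr pZ// ltW.
exists L; split=> // [x|v Wv]; first exact: le_trans (Elex x).
rewrite -oppr_le0 -mulN1r -LZ scaleN1r (le_trans (LE _))//.
apply: ge_inf => //; exists [:: (1, v)].
  by move=> i; rewrite inE => /eqP ->.
by rewrite big_seq1 scale1r addNr (sublinear0 psub).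
Qed.

End linear_minorant.

(** * Integration of simple functions against a finitely additive probability *)

Section simple_integral.
Context (R : realType) (T : Type) (m : set T -> R).
Hypothesis m_prob : finadd_probability m.

Let mU (A B : set T) : A `&` B = set0 -> m (A `|` B) = m A + m B.
Proof. by case: m_prob => _ _; apply. Qed.

Lemma finadd_set0 : m set0 = 0.
Proof. by apply/eqP; rewrite -(inj_eq (addrI (m set0))) -mU ?setI0// setU0 addr0. Qed.

Lemma finadd_le (A B : set T) : A `<=` B -> m A <= m B.
Proof.
move=> AB; rewrite -(setDUK AB) mU ?lerDl; last first.
  by apply/seteqP; split=> x // [Ax []].
by case: m_prob.
Qed.

Lemma finadd_leU (A B : set T) : m (A `|` B) <= m A + m B.
Proof.
rewrite -(setDUK (@subsetUl _ A B)) mU ?lerD2l; first by apply: finadd_le => x [[]].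
by apply/seteqP; split => x // [Ax [_ /(_ Ax)]].
Qed.

Lemma finadd_fibers (I : eqType) (k : T -> I) (r : seq I) : uniq r ->
  m (k @^-1` [set` r]) = \sum_(i <- r) m (k @^-1` [set i]).
Proof.
elim: r => [_|i r IH /= /andP[ir ur]].
  by rewrite big_nil -[RHS]finadd_set0; congr m; apply/seteqP; split.
rewrite big_cons -IH// -mU.
  congr m; apply/seteqP; split=> t /=; rewrite inE.
    by move=> /orP[/eqP|]; [left|right].
  by move=> [->|->]; rewrite ?eqxx ?orbT.
by apply/seteqP; split=> t // [/= ->]; exact/negP.
Qed.

(** Real-valued counterpart of [sintegral], whose values are extended reals; [sintegral_sint]
    identifies the two on functions with finite range. *)
Definition sint (s : T -> R) : R := \sum_(r \in range s) r * m (s @^-1` [set r]).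

Lemma finite_range_comp (I J : Type) (k : T -> I) (a : I -> J) :
  finite_set (range k) -> finite_set (range (a \o k)).
Proof. move=> kfin; rewrite -(image_comp k a); exact: finite_image. Qed.

Lemma finite_range_pair (I J : Type) (s : T -> I) (t : T -> J) :
  finite_set (range s) -> finite_set (range t) ->
  finite_set (range (fun w => (s w, t w))).
Proof.
move=> sfin tfin; apply: sub_finite_set (finite_setX sfin tfin).
by move=> _ [w _ <-]; split=> /=; exists w.
Qed.

(** The fibers of [k] are grouped according to the value of [a], and [m] is additive on each group.
    With [k] the pair of two simple functions, this is the common refinement behind [sintD] and
    [sint_le]. *)
Lemma sint_comp (I : choiceType) (k : T -> I) (a : I -> R) :
  finite_set (range k) ->
  sint (a \o k) = \sum_(i <- fset_set (range k)) a i * m (k @^-1` [set i]).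
Proof.
move=> kfin; have afin := finite_range_comp a kfin.
rewrite /sint fsbig_finite//=.
transitivity (\sum_(r <- fset_set (range (a \o k)))
    \sum_(i <- fset_set (range k) | a i == r) a i * m (k @^-1` [set i])).
  apply: eq_bigr => r _.
  rewrite (eq_bigr (fun i => r * m (k @^-1` [set i]))); last by move=> i /eqP ->.
  rewrite -mulr_sumr -big_filter -finadd_fibers ?filter_uniq ?fset_uniq//.
  congr (r * m _); apply/seteqP; split=> t /=; rewrite mem_filter.
    by move=> ->; rewrite eqxx /= in_fset_set//; apply: mem_set; exists t.
  by move=> /andP[/eqP].
rewrite (exchange_big_dep xpredT)//= [LHS]big_seq [RHS]big_seq.
apply: eq_bigr => i; rewrite in_fset_set// => /set_mem[t _ <-].
under eq_bigl do rewrite eq_sym.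
rewrite -big_filter filter_pred1_uniq ?fset_uniq ?big_seq1// in_fset_set//.
by apply: mem_set; exists t.
Qed.

Lemma sint_cst (c : R) : sint (fun=> c) = c.
Proof.
have cfin : finite_set (range (fun _ : T => c)) by exact: finite_image_cst.
rewrite -[fun=> c]/((fun=> c) \o (fun=> c)) sint_comp// -mulr_sumr.
rewrite -finadd_fibers ?fset_uniq// (_ : _ @^-1` _ = setT).
  by case: m_prob => _ -> _; rewrite mulr1.
by apply/seteqP; split=> // t _ /=; rewrite in_fset_set//; apply: mem_set; exists t.
Qed.

Lemma sint_indic (c : R) (E : set T) :
  sint (fun w => if `[< E w >] then c else 0) = c * m E.
Proof.
pose k w := `[< E w >]; pose a (b : bool) := if b then c else 0.
have kfin : finite_set (range k) by exact: finite_finset.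
rewrite -[LHS]/(sint (a \o k)) sint_comp//.
rewrite (bigID id)/= [X in _ + X]big1 ?addr0; last by move=> [] //= _; rewrite mul0r.
rewrite (eq_bigr (fun i => c * m (k @^-1` [set i]))); last by move=> [].
rewrite -mulr_sumr -big_filter -finadd_fibers ?filter_uniq ?fset_uniq//.
congr (c * m _); apply/seteqP; split=> t /=; rewrite mem_filter.
  by move=> /andP[/asboolP].
move=> Et; have kt : k t by exact/asboolP.
by rewrite kt /= in_fset_set//; apply: mem_set; exists t.
Qed.

Lemma sintD (s t : T -> R) : finite_set (range s) -> finite_set (range t) ->
  sint (fun w => s w + t w) = sint s + sint t.
Proof.
move=> sfin tfin; have kfin := finite_range_pair sfin tfin.
rewrite -[LHS]/(sint ((fun p => p.1 + p.2) \o (fun w => (s w, t w)))).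
rewrite -[sint s]/(sint (fst \o (fun w => (s w, t w)))).
rewrite -[sint t]/(sint (snd \o (fun w => (s w, t w)))).
by rewrite !sint_comp//= -big_split/=; apply: eq_bigr => i _; rewrite mulrDl.
Qed.

Lemma sintZ (c : R) (s : T -> R) : finite_set (range s) ->
  sint (fun w => c * s w) = c * sint s.
Proof.
move=> sfin; rewrite -[LHS]/(sint ((fun r => c * r) \o s)).
rewrite -[sint s]/(sint (id \o s)) !sint_comp// mulr_sumr/=.
by apply: eq_bigr => i _; rewrite mulrA.
Qed.

Lemma sint_le (s t : T -> R) : finite_set (range s) -> finite_set (range t) ->
  (forall w, s w <= t w) -> sint s <= sint t.
Proof.
move=> sfin tfin st; have kfin := finite_range_pair sfin tfin.
rewrite -[sint s]/(sint (fst \o (fun w => (s w, t w)))).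
rewrite -[sint t]/(sint (snd \o (fun w => (s w, t w)))).
rewrite !sint_comp//= [leLHS]big_seq [leRHS]big_seq; apply: ler_sum => i.
rewrite in_fset_set// => /set_mem[w _ <-] /=.
by apply: ler_wpM2r => //; case: m_prob.
Qed.

Lemma sintegral_sint (s : T -> R) : finite_set (range s) ->
  sintegral (EFin \o m) s = (sint s)%:E.
Proof.
move=> sfin; rewrite /sintegral /sint -fsumEFin//.
(* [sintegral] sums over all reals; a value off the range has an empty preimage, of mass 0. *)
rewrite [RHS](fsbig_widen (range s) setT)// => r [_ nr] /=.
by rewrite preimage10// finadd_set0 mulr0.
Qed.

End simple_integral.

(** * The Dunford-Schwartz integral: linearity and monotonicity *)

Section DS_theory.
Context (R : realType) (T : Type) (m : set T -> R).
Hypothesis m_prob : finadd_probability m.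

(** An elementary form of [DS_integral], with explicit bounds for filters, reals for extended reals,
    and functions of finite range for bundled simple functions. The limit arguments are carried out
    on this form. *)
Definition DS_eps (phi : T -> R) (v : R) : Prop :=
  exists s : nat -> T -> R,
    [/\ forall n, finite_set (range (s n)),
        forall e d, 0 < e -> 0 < d -> exists N, forall n, (N <= n)%N ->
          m [set w | e < `|s n w - phi w|] < d,
        forall d, 0 < d -> exists N, forall p q, (N <= p)%N -> (N <= q)%N ->
          sint m (fun w => `|s p w - s q w|) < d &
        forall d, 0 < d -> exists N, forall n, (N <= n)%N ->
          `|sint m (s n) - v| < d].

Let finite_norm (s : T -> R) : finite_set (range s) ->
  finite_set (range (fun w => `|s w|)).
Proof. exact: (finite_range_comp (fun r : R => `|r|)). Qed.

Let finite_scale (c : R) (s : T -> R) : finite_set (range s) ->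
  finite_set (range (fun w => c * s w)).
Proof. exact: (finite_range_comp (fun r : R => c * r)). Qed.

Let finite_add (s t : T -> R) : finite_set (range s) -> finite_set (range t) ->
  finite_set (range (fun w => s w + t w)).
Proof.
move=> sfin tfin.
exact: (finite_range_comp (fun p => p.1 + p.2) (finite_range_pair sfin tfin)).
Qed.

Let finite_dist (s t : T -> R) : finite_set (range s) -> finite_set (range t) ->
  finite_set (range (fun w => `|s w - t w|)).
Proof.
move=> sfin tfin.
exact: (finite_range_comp (fun p => `|p.1 - p.2|) (finite_range_pair sfin tfin)).
Qed.

Ltac finite_range := solve [repeat first
  [ assumption | exact: finite_image_cst | apply: finite_dist
  | apply: finite_norm | apply: finite_scale | apply: finite_add
  | match goal with H : forall n, finite_set (range _) |- _ => exact: H end ]].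
#[local] Hint Extern 0 (finite_set _) => finite_range : core.

Let sint_ge0 (s : T -> R) : finite_set (range s) -> (forall w, 0 <= s w) ->
  0 <= sint m s.
Proof.
move=> sfin s0; rewrite -[leLHS](sint_cst m_prob).
by apply: sint_le => //; exact: finite_image_cst.
Qed.

Lemma DS_integralP (phi : T -> R) (v : R) :
  DS_integral m phi v <-> DS_eps phi v.
Proof.
split=> [[s [sphi scauchy sv]]|[s [sfin sphi scauchy sv]]].
  have sfin n : finite_set (range (s n)) by exact: fimfunP.
  exists s; split=> // [e d e0 d0|d d0|d d0].
  - have /cvgr0Pnorm_lt/(_ _ d0)[N _ HN] := sphi e e0.
    by exists N => n /HN; apply: le_lt_trans; exact: ler_norm.
  - have {}scauchy : sint m (fun w => `|s p.1 w - s p.2 w|) @[p --> (\oo, \oo)]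
        --> (0 : R).
      have := scauchy; under eq_fun do rewrite (sintegral_sint m_prob)//.
      by move=> /fine_cvgP[].
    have /cvgr0Pnorm_lt/(_ _ d0)[[A B] /= [[N1 _ A1] [N2 _ B2]] AB] := scauchy.
    exists (maxn N1 N2) => p q; rewrite !geq_max => /andP[pN _] /andP[_ qN].
    apply: le_lt_trans (ler_norm _) _; apply: (AB (p, q)); split; [exact: A1|exact: B2].
  - have {}sv : sint m (s n) @[n --> \oo] --> v.
      have := sv; under eq_fun do rewrite (sintegral_sint m_prob)//.
      by move=> /fine_cvgP[].
    have /cvgrPdist_lt/(_ _ d0)[N _ HN] := sv.
    by exists N => n /HN; rewrite distrC.
exists (fun n => fimfun_Sub (mem_set (sfin n))); split=> [e e0||].
- apply/cvgr0Pnorm_lt => d d0; have [N HN] := sphi _ _ e0 d0.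
  by exists N => // n /HN; rewrite ger0_norm//; case: m_prob.
- under eq_fun do rewrite (sintegral_sint m_prob)//.
  apply/fine_cvgP; split; first by near=> p.
  apply/cvgr0Pnorm_lt => d d0; have [N HN] := scauchy _ d0.
  exists ([set n | (N <= n)%N], [set n | (N <= n)%N]) => /=.
    by split; exists N.
  by move=> [p q] /= [Np Nq]; rewrite ger0_norm ?HN// sint_ge0//.
- under eq_fun do rewrite (sintegral_sint m_prob)//.
  apply/fine_cvgP; split; first by near=> p.
  apply/cvgrPdist_lt => d d0; have [N HN] := sv _ d0.
  by exists N => // n /HN; rewrite distrC.
Unshelve. all: by end_near. Qed.

Lemma DS_eps_cst (c : R) : DS_eps (fun=> c) c.
Proof.
exists (fun _ _ => c); split=> [n|e d e0 d0|d d0|d d0].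
- exact: finite_image_cst.
- exists 0%N => n _; rewrite (_ : [set _ | _] = set0) ?finadd_set0//.
  by apply/seteqP; split=> // w /=; rewrite subrr normr0 ltNge (ltW e0).
- by exists 0%N => p q _ _; rewrite subrr normr0 sint_cst.
- by exists 0%N => n _; rewrite sint_cst// subrr normr0.
Qed.

Lemma DS_epsD (phi psi : T -> R) (u v : R) : DS_eps phi u -> DS_eps psi v ->
  DS_eps (fun w => phi w + psi w) (u + v).
Proof.
move=> [s [sfin sphi sC su]] [t [tfin tpsi tC tv]].
exists (fun n w => s n w + t n w); split=> [n|e d e0 d0|d d0|d d0].
- exact: finite_add.
- have [N1 H1] := sphi (e / 2) (d / 2) ltac:(lra) ltac:(lra).
  have [N2 H2] := tpsi (e / 2) (d / 2) ltac:(lra) ltac:(lra).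
  exists (maxn N1 N2) => n; rewrite geq_max => /andP[/H1 {}H1 /H2 {}H2].
  rewrite (splitr d); apply: le_lt_trans (ltrD H1 H2).
  (* If the sum deviates by more than [e], one of the summands deviates by more than [e / 2]. *)
  apply: le_trans (finadd_leU m_prob _ _); apply: finadd_le => // w /= H.
  apply/orP; rewrite -implyNb -leNgt; apply/implyP => Hs; rewrite ltNge.
  apply/negP => Ht; move: H; rewrite ltNge => /negP; apply.
  rewrite opprD addrACA (splitr e); apply: le_trans (ler_normD _ _) _; exact: lerD.
- have [N1 H1] := sC (d / 2) ltac:(lra).
  have [N2 H2] := tC (d / 2) ltac:(lra).
  exists (maxn N1 N2) => p q; rewrite !geq_max => /andP[p1 p2] /andP[q1 q2].
  rewrite (splitr d); apply: le_lt_trans (ltrD (H1 _ _ p1 q1) (H2 _ _ p2 q2)).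
  rewrite -sintD//; apply: sint_le => //.
  by move=> w; rewrite opprD addrACA ler_normD.
- have [N1 H1] := su (d / 2) ltac:(lra).
  have [N2 H2] := tv (d / 2) ltac:(lra).
  exists (maxn N1 N2) => n; rewrite !geq_max => /andP[n1 n2].
  rewrite sintD// opprD addrACA (splitr d).
  by apply: le_lt_trans (ltrD (H1 _ n1) (H2 _ n2)); exact: ler_normD.
Qed.

Lemma DS_epsZ (c : R) (phi : T -> R) (v : R) : DS_eps phi v ->
  DS_eps (fun w => c * phi w) (c * v).
Proof.
(* Adding 1 keeps the divisor [k] positive when [c = 0]. *)
move=> [s [sfin sphi sC sv]]; pose k := `|c| + 1.
have k0 : 0 < k by rewrite ltr_wpDl.
have small x d : `|x| <= d / k -> `|c * x| <= d.
  move=> xd; rewrite normrM (@le_trans _ _ (k * `|x|))//.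
    by rewrite ler_wpM2r// lerDl.
  by rewrite mulrC -ler_pdivlMr.
have small_lt x d : 0 < d -> `|x| < d / k -> `|c * x| < d.
  move=> d0 xd; rewrite normrM (@le_lt_trans _ _ (k * `|x|))//.
    by rewrite ler_wpM2r// lerDl.
  by rewrite mulrC -ltr_pdivlMr.
exists (fun n w => c * s n w); split=> [n|e d e0 d0|d d0|d d0].
- exact: finite_scale.
- have [N HN] := sphi (e / k) d (divr_gt0 e0 k0) d0.
  exists N => n /HN; apply: le_lt_trans; apply: finadd_le => // w /=.
  by rewrite !ltNge; apply: contra; rewrite -mulrBr; exact: small.
- have [N HN] := sC (d / k) (divr_gt0 d0 k0).
  exists N => p q /HN/[apply] H.
  rewrite (_ : (fun w => _) = (fun w => `|c| * `|s p w - s q w|)); last first.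
    by apply/funext => w; rewrite -mulrBr normrM.
  rewrite sintZ//.
  have := small_lt (sint m (fun w => `|s p w - s q w|)) d d0.
  have I0 := sint_ge0 (finite_dist (sfin p) (sfin q)) (fun=> normr_ge0 _).
  by rewrite normrM (ger0_norm I0); apply.
- have [N HN] := sv (d / k) (divr_gt0 d0 k0).
  by exists N => n /HN; rewrite sintZ// -mulrBr; exact: small_lt.
Qed.

(** Makes [[g, h]] the integral of [[f, h]] over [f] when each [g x] is the integral of [f x]. *)
Lemma DS_eps_sum (I : Type) (r : seq I) (h : I -> R) (phi : I -> T -> R)
    (v : I -> R) : (forall i, DS_eps (phi i) (v i)) ->
  DS_eps (fun w => \sum_(i <- r) h i * phi i w) (\sum_(i <- r) h i * v i).
Proof.
move=> phiv; elim: r => [|i r IH].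
  by rewrite big_nil; under eq_fun do rewrite big_nil; exact: DS_eps_cst.
rewrite big_cons; under eq_fun do rewrite big_cons.
by apply: DS_epsD => //; exact: DS_epsZ.
Qed.

(* If phi <= M, then S_n <= M + e + |S_n - S_k| + C 1_E with C a bound of
   |S_k| and |M + e|, and E = {e < |S_n - phi|} of vanishing probability. *)
Lemma DS_eps_le (phi : T -> R) (v M : R) : DS_eps phi v ->
  (forall w, phi w <= M) -> v <= M.
Proof.
move=> [s [sfin sphi sC sv]] phiM; apply/ler_addgt0Pr => d d0.
(* Four errors of size [e] add up: the distance from [v] to the integral of [s n], the slack in
   [s n <= phi + e], the mean distance from [s n] to [s k], and [C * m E]. *)
pose e := d / 4; have e0 : 0 < e by rewrite /e; lra.
have [k Hk] := sC e e0; have [N1 H1] := sv e e0.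
have [C [C0 HC]] : exists C, 0 < C /\ forall w, `|s k w| + `|M + e| <= C.
  have /finite_seqP[l lE] := finite_norm (sfin k).
  exists (\sum_(r <- l) `|r| + `|M + e| + 1); split.
    by rewrite ltr_wpDl// addr_ge0// sumr_ge0.
  move=> w; rewrite -addrA lerD// ?lerDl//.
  have H : [set` l] `|s k w| by rewrite -lE; exists w.
  by rewrite (big_rem _ H)/= normr_id lerDl sumr_ge0.
have [N2 H2] := sphi e (e / C) e0 (divr_gt0 e0 C0).
pose n := maxn k (maxn N1 N2).
have kn : (k <= n)%N by rewrite leq_maxl.
have n1 : (N1 <= n)%N by rewrite leq_max leq_maxl orbT.
have n2 : (N2 <= n)%N by rewrite leq_max leq_maxr orbT.
pose E := [set w | e < `|s n w - phi w|].
have Ifin : finite_set (range (fun w => if `[< E w >] then C else 0)).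
  pose k' w := `[< E w >]; have k'fin : finite_set (range k') by exact: finite_finset.
  exact: (finite_range_comp (fun b : bool => if b then C else 0) k'fin).
have cfin (c : R) : finite_set (range (fun _ : T => c)) by exact: finite_image_cst.
have bound : sint m (s n) <=
    (M + e) + sint m (fun w => `|s n w - s k w|) + C * m E.
  rewrite -[X in X + _ + _](sint_cst m_prob) -(sint_indic m_prob).
  rewrite -sintD// -sintD//.
  apply: sint_le => // w; case: asboolP => [Ew|/negP]/=.
    have := HC w; have := ler_norm (s k w); have := ler_norm (- (M + e)).
    by have := ler_norm (s n w - s k w); rewrite normrN => *; lra.
  rewrite -leNgt ler_norml => /andP[_ sphin].
  by have := phiM w; have := normr_ge0 (s n w - s k w) => *; lra.
have mE : C * m E < e by rewrite mulrC -ltr_pdivlMr//; exact: H2.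
have := H1 _ n1; rewrite ltr_norml => /andP[vn _].
have dn := Hk n k kn (leqnn _).
have de : d = 4 * e by rewrite /e; lra.
lra.
Qed.

Lemma DS_eps_ge0 (phi : T -> R) (v : R) : DS_eps phi v ->
  (forall w, 0 <= phi w) -> 0 <= v.
Proof.
move=> /(DS_epsZ (-1)) /DS_eps_le H phi0; rewrite -oppr_le0 -mulN1r.
by apply: H => w; rewrite mulN1r oppr_le0.
Qed.

End DS_theory.

(** * The module of bounded functions *)

Definition bounded_functions (R : realType) (T : Type) : {pred T -> R} :=
  mem [set phi : T -> R | exists M, forall t, `|phi t| <= M].

Lemma bounded_functionsP (R : realType) (T : Type) (phi : T -> R) :
  phi \in @bounded_functions R T <-> exists M, forall t, `|phi t| <= M.
Proof. by split=> [/set_mem|/mem_set]. Qed.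

Lemma bounded_submod_closed (R : realType) (T : Type) :
  submod_closed (@bounded_functions R T).
Proof.
split=> [|c phi psi].
  by apply/bounded_functionsP; exists 0 => t; rewrite normr0.
move=> /bounded_functionsP[M phiM] /bounded_functionsP[N psiN].
apply/bounded_functionsP; exists (`|c| * M + N) => t.
by rewrite (le_trans (ler_normD _ _))// lerD// normrM ler_wpM2l.
Qed.

HB.instance Definition _ (R : realType) (T : Type) :=
  GRing.isSubmodClosed.Build R (T -> R) (@bounded_functions R T)
    (@bounded_submod_closed R T).

(** Hahn-Banach is applied on this subtype because the dominating functional is a supremum, which
    would be a default value on functions unbounded above. *)
Definition bounded_fun_type (R : realType) (T : Type) :=
  {phi : T -> R | phi \in @bounded_functions R T}.
HB.instance Definition _ (R : realType) (T : Type) :=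
  SubChoice.on (bounded_fun_type R T).
HB.instance Definition _ (R : realType) (T : Type) :=
  [SubChoice_isSubLmodule of bounded_fun_type R T by <:].

(** * Finitely additive probabilities from positive functionals *)

Section finadd_existence.
Context (R : realType) (T : Type) (t0 : T).

Let B := @bounded_functions R T.

Let S (phi : bounded_fun_type R T) : R := sup (range (val phi)).

Let range0 (phi : T -> R) : range phi !=set0.
Proof. by exists (phi t0), t0. Qed.

Let S_ub (phi : bounded_fun_type R T) t : val phi t <= S phi.
Proof.
apply: ub_le_sup; last by exists t.
have /bounded_functionsP[M phiM] := valP phi.
by exists M => _ [u _ <-]; exact: le_trans (ler_norm _) (phiM u).
Qed.

Let S_le (phi : bounded_fun_type R T) M : (forall t, val phi t <= M) -> S phi <= M.
Proof. by move=> phiM; apply: ge_sup => // _ [t _ <-]. Qed.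

Let S_sublinear : sublinear S.
Proof.
apply: sublinearP => [phi psi||c phi c0].
- by apply: S_le => t; rewrite /= lerD// S_ub.
- by apply/eqP; rewrite eq_le S_le//= (S_ub 0 t0).
- by apply: S_le => t; rewrite /= ler_wpM2l ?S_ub// ltW.
Qed.

(** Hahn-Banach below the supremum functional [S]: the hypothesis says that conic combinations of
    [W] have non-negative supremum. Domination by [S] makes [L] positive and gives it the value 1 at
    the constant 1. *)
Lemma positive_functional (W : set (T -> R)) : W `<=` [set` B] ->
  (forall l : seq (R * (T -> R)), (forall i, i \in l -> 0 <= i.1 /\ W i.2) ->
    forall e, 0 < e -> exists t, - e < \sum_(i <- l) i.1 * i.2 t) ->
  exists L : (T -> R) -> R,
    [/\ forall phi psi, phi \in B -> psi \in B ->
          L (fun t => phi t + psi t) = L phi + L psi,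
        forall c phi, phi \in B -> L (fun t => c * phi t) = c * L phi,
        forall M phi, phi \in B -> (forall t, phi t <= M) -> L phi <= M &
        forall phi, W phi -> 0 <= L phi].
Proof.
move=> WB Wl; have [|L [LD LZ LS LW]] :=
    linear_minorant_ge0 (W := val @^-1` W) S_sublinear.
  move=> l lW; apply/ler_addgt0Pr => e e0.
  have [|t te] := Wl [seq (i.1, val i.2) | i <- l] _ e e0.
    by move=> i /mapP[j /lW jW ->].
  rewrite -lerBlDr sub0r (le_trans (ltW te))//.
  rewrite big_map/= (le_trans _ (S_ub _ t))//.
  by elim/big_rec2: _ => // i u phi _ uphi; rewrite /= lerD2l.
(* [L] is extended by 0 off the bounded functions, so as to act on plain functions. *)
pose L' phi := if pselect (phi \in B) is left h then L (exist _ phi h) else 0.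
have L'E (phi : bounded_fun_type R T) : L' (val phi) = L phi.
  rewrite /L'; case: pselect => [h|/(_ (valP phi))//].
  by congr L; exact: val_inj.
exists L'; split=> [phi psi hphi hpsi|c phi hphi|M phi hphi phiM|phi Wphi].
- rewrite -[phi]/(val (exist _ phi hphi : bounded_fun_type R T)).
  rewrite -[psi]/(val (exist _ psi hpsi : bounded_fun_type R T)).
  by rewrite !L'E -LD -L'E.
- rewrite -[phi]/(val (exist _ phi hphi : bounded_fun_type R T)).
  by rewrite !L'E -LZ -L'E.
- rewrite -[phi]/(val (exist _ phi hphi : bounded_fun_type R T)) L'E.
  by rewrite (le_trans (LS _))// S_le.
- rewrite -[phi]/(val (exist _ phi (WB _ Wphi) : bounded_fun_type R T)) L'E.
  exact: LW.
Qed.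

Lemma bounded_finite_range (s : T -> R) : finite_set (range s) -> s \in B.
Proof.
move=> /finite_seqP[l lE]; apply/bounded_functionsP; exists (\sum_(r <- l) `|r|) => t.
have H : [set` l] (s t) by rewrite -lE; exists t.
by rewrite (big_rem _ H)/= lerDl sumr_ge0.
Qed.

(** The function [phi + M], with values between 0 and [2 * M], is rounded down to multiples of
    [d]. *)
Lemma uniform_simple_approx (phi : T -> R) (d : R) : phi \in B -> 0 < d ->
  exists2 s : T -> R, finite_set (range s) & forall t, `|s t - phi t| <= d.
Proof.
move=> /bounded_functionsP[M phiM] d0; pose k t := Num.truncn ((phi t + M) / d).
have phi0 t : 0 <= (phi t + M) / d.
  by apply: divr_ge0 (ltW d0); have := phiM t; rewrite ler_norml => /andP[? _]; lra.
exists (fun t => (k t)%:R * d - M).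
  apply: (finite_range_comp (fun n => n%:R * d - M)).
  apply: (@sub_finite_set _ _ `I_(Num.truncn (2 * M / d)).+1); last exact: finite_II.
  move=> _ [t _ <-] /=; rewrite ltnS le_truncn// ler_wpM2r ?invr_ge0 ?(ltW d0)//.
  by have := phiM t; rewrite ler_norml => /andP[_ ?]; lra.
move=> t; have /andP[] := truncn_itv (phi0 t); rewrite -/(k t).
rewrite ler_pdivlMr// ltr_pdivrMr// -natr1 mulrDl mul1r => k1 k2.
by rewrite ler_norml; apply/andP; split; lra.
Qed.

(** The mass of [A] is [L] at the indicator of [A]. Then [sint m] agrees with [L] on simple
    functions, and since [L] is 1-Lipschitz for the uniform norm, uniform simple approximations
    extend this to bounded functions. *)
Lemma finadd_of_functional (L : (T -> R) -> R) :
  (forall phi psi, phi \in B -> psi \in B ->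
    L (fun t => phi t + psi t) = L phi + L psi) ->
  (forall c phi, phi \in B -> L (fun t => c * phi t) = c * L phi) ->
  (forall M phi, phi \in B -> (forall t, phi t <= M) -> L phi <= M) ->
  exists2 m : set T -> R, finadd_probability m &
    forall phi, phi \in B -> DS_eps m phi (L phi).
Proof.
move=> LD LZ LM.
have BD phi psi : phi \in B -> psi \in B -> (fun t => phi t + psi t) \in B.
  by move=> hphi hpsi; exact: (rpredD hphi hpsi).
have BZ c phi : phi \in B -> (fun t => c * phi t) \in B.
  by move=> hphi; exact: (rpredZ c hphi).
have Bcst c : (fun=> c) \in B.
  by apply: bounded_finite_range; exact: finite_image_cst.
have BI (A : set T) : (\1_A : T -> R) \in B.
  apply: bounded_finite_range; pose k w := `[< A w >].
  have kfin : finite_set (range k) by exact: finite_finset.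
  rewrite (_ : \1_A = (fun b : bool => b%:R : R) \o k); first exact: finite_range_comp.
  by apply/funext => t.
have LB phi psi : phi \in B -> psi \in B ->
    L (fun t => phi t - psi t) = L phi - L psi.
  move=> hphi hpsi; rewrite -[L psi]mul1r -mulNr -LZ// -LD ?BZ//.
  by congr L; apply/funext => t; rewrite mulN1r.
have Lge0 phi : phi \in B -> (forall t, 0 <= phi t) -> 0 <= L phi.
  move=> hphi phi0; rewrite -oppr_le0 -mulN1r -LZ// LM ?BZ// => t.
  by rewrite mulN1r oppr_le0.
have Lcst c : L (fun=> c) = c.
  apply/eqP; rewrite eq_le LM//= -lerN2 -mulN1r -LZ// LM ?BZ// => t.
  by rewrite mulN1r.
have Ldist phi psi (d : R) : phi \in B -> psi \in B ->
    (forall t, `|phi t - psi t| <= d) -> `|L phi - L psi| <= d.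
  move=> hphi hpsi phipsi; rewrite ler_norml lerNl opprB -!LB//.
  apply/andP; split; apply: LM; rewrite ?(rpredB hphi hpsi) ?(rpredB hpsi hphi)// => t.
    by have := phipsi t; rewrite distrC; apply: le_trans; exact: ler_norm.
  by have := phipsi t; apply: le_trans; exact: ler_norm.
pose m (A : set T) := L \1_A.
have m_prob : finadd_probability m.
  split=> [A||A A' AA'].
  - by apply: Lge0 => // t; rewrite indicE.
  - by rewrite /m indicT; exact: Lcst.
  - rewrite /m -LD//; congr L; apply/funext => t.
    have nAA' : ~ (A `&` A') t by rewrite AA'.
    rewrite !indicE in_setU; case: (boolP (t \in A)); case: (boolP (t \in A'));
      rewrite ?addr0 ?add0r// => /set_mem At' /set_mem At.
    by case: nAA'; split.
have Lsum (l : seq R) (h : R -> R) (A : R -> set T) :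
    (fun t => \sum_(r <- l) h r * \1_(A r) t) \in B /\
    L (fun t => \sum_(r <- l) h r * \1_(A r) t) = \sum_(r <- l) h r * m (A r).
  elim: l => [|r l [IHB IHL]].
    by under eq_fun do rewrite big_nil; rewrite big_nil.
  under eq_fun do rewrite big_cons; rewrite big_cons LD ?BZ// LZ// IHL.
  by split=> //; apply: BD => //; exact: BZ.
have sintL s : finite_set (range s) -> sint m s = L s.
  move=> sfin; rewrite /sint fsbig_finite// -(Lsum _ id (fun r => s @^-1` [set r])).2; congr L.
  apply/funext => t; have st : s t \in fset_set (range s).
    by rewrite in_fset_set//; apply: mem_set; exists t.
  rewrite (bigD1_seq (s t)) ?fset_uniq//= indicE mem_set// mulr1 big1 ?addr0// => r rs.
  rewrite indicE memNset ?mulr0// => /esym/eqP.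
  by apply/negP.
exists m => // phi hphi.
have d0 n : 0 < n.+1%:R^-1 :> R by rewrite invr_gt0.
pose s n := sval (cid2 (uniform_simple_approx hphi (d0 n))).
have sfin n : finite_set (range (s n)) by rewrite /s; case: cid2.
have sphi n t : `|s n t - phi t| <= n.+1%:R^-1 by rewrite /s; case: cid2.
have sB n : s n \in B by exact: bounded_finite_range.
have small (e : R) : 0 < e -> exists N, forall n, (N <= n)%N -> n.+1%:R^-1 < e.
  by move=> e0; have [N _ HN] := near_infty_natSinv_lt (PosNum e0); exists N.
exists s; split=> // [e d e0 dgt0|d' d'0|d' d'0].
- have [N HN] := small e e0; exists N => n /HN ne.
  suff -> : [set w | e < `|s n w - phi w|] = set0 by rewrite finadd_set0.
  apply/seteqP; split=> // w /=; apply/negP; rewrite -leNgt.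
  by rewrite (le_trans (sphi n w))// ltW.
- have [N HN] := small (d' / 2) ltac:(lra); exists N => p q /HN Np /HN Nq.
  apply: (@le_lt_trans _ _ (p.+1%:R^-1 + q.+1%:R^-1)); last by rewrite (splitr d') ltrD.
  rewrite -[leRHS](sint_cst m_prob); apply: sint_le => //.
  + exact: (finite_range_comp (fun p => `|p.1 - p.2|) (finite_range_pair (sfin p) (sfin q))).
  + exact: finite_image_cst.
  + move=> w; rewrite (le_trans (ler_distD (phi w) _ _))// lerD// distrC; exact: sphi.
- have [N HN] := small d' d'0; exists N => n /HN; apply: le_lt_trans.
  by rewrite sintL//; apply: Ldist.
Qed.

End finadd_existence.

(** * Positivity of [I_of] and members of [Int] bounded below *)

Section positivity.
Context (R : realType) (X : choiceType) (F : set (X -> R)).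
Hypothesis F01 : forall f, F f -> forall x, 0 <= f x <= 1.

Lemma nnsup_leP (A : set R) (M : \bar R) :
  (nnsup A <= M)%E <-> (0 <= M)%E /\ forall a, A a -> (a%:E <= M)%E.
Proof.
split=> [AM|[M0 AM]].
  by split=> [|a Aa]; apply: le_trans AM; apply: ereal_sup_ubound;
    [exists 0 => //; left|exists a => //; right].
by apply: ge_ereal_sup => _ [a [->|Aa] <-] //; exact: AM.
Qed.

Lemma nnsup_eq0P (A : set R) : nnsup A = 0%E <-> forall a, A a -> a <= 0.
Proof.
split=> [A0 a Aa|A0].
  by have /nnsup_leP[_ /(_ _ Aa)] : (nnsup A <= 0)%E by rewrite A0.
apply/eqP; rewrite eq_le; apply/andP; split.
  by apply/nnsup_leP; split=> // a /A0; rewrite lee_fin.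
by have /nnsup_leP[] := lexx (nnsup A).
Qed.

Let minE (f : X -> R) : F f -> (fun x => Num.min `|f x| 1) = f.
Proof.
move=> Ff; apply/funext => x; have /andP[f0 f1] := F01 Ff x.
by rewrite ger0_norm// min_l.
Qed.

Lemma I_of_ge_Int (U : set X) (g : X -> R) (c : R) : Int F g ->
  (forall x, U x -> c <= g x) -> (c%:E <= I_of F U)%E.
Proof.
move=> [m [m_prob gm]] Ug; apply: le_ereal_inf_tmp => _ [h [h0 hfin hU h1] <-].
(* The negated goal puts the supremum [s] below [c], so [s] is finite and gives a real upper bound
   for all [[f, h]]. *)
rewrite leNgt; apply/negP; set s := nnsup _ => sc.
have /nnsup_leP[s0 sF] := lexx s.
have sr : s = (fine s)%:E.
  by rewrite fineK// ge0_fin_numE// (lt_le_trans sc)// leey.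
rewrite sr in sc sF; rewrite lte_fin in sc.
pose l := fset_set [set x | h x != 0].
have bracketE (f : X -> R) : bracket f h = \sum_(x <- l) h x * f x.
  rewrite /bracket (fsbigTE l); first by apply: eq_bigr => x _; rewrite mulrC.
  move=> x; rewrite in_fset_set// => /negP xl.
  have [->|hx] := eqVneq (h x) 0; first by rewrite mulr0.
  by exfalso; apply: xl; exact: mem_set.
have : \sum_(x <- l) h x * g x <= fine s.
  apply: (@DS_eps_le _ _ _ m_prob (fun w => \sum_(x <- l) h x * val w x)).
    by apply: DS_eps_sum => // x; exact/(DS_integralP m_prob).
  move=> w; rewrite -lee_fin -bracketE; apply: sF.
  by exists (val w); [exact: set_valP|rewrite minE//; exact: set_valP].
apply/negP; rewrite -ltNge (lt_le_trans sc)//.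
rewrite -[c]mul1r -h1 (fsbigTE l); last first.
  move=> x; rewrite in_fset_set// => /negP xl; apply/eqP/negPn/negP => hx.
  by apply: xl; exact: mem_set.
rewrite mulr_suml [leLHS]big_seq [leRHS]big_seq; apply: ler_sum => x.
rewrite in_fset_set// => /set_mem hx.
by apply: ler_wpM2l => //; apply: Ug; exact: hU.
Qed.

(** Merging repeated points and dividing by the total weight turns [l] into a member [h] of
    [Delta U]. The slack [e] is there because the supremum over [F] need not be attained. *)
Lemma I_of_le_conic (U : set X) (c e : R) (l : seq (R * X)) :
  0 < c -> 0 < e -> (c%:E <= I_of F U)%E ->
  (forall i, i \in l -> 0 <= i.1 /\ U i.2) -> 0 < \sum_(i <- l) i.1 ->
  exists2 f, F f & (c - e) * \sum_(i <- l) i.1 < \sum_(i <- l) i.1 * f i.2.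
Proof.
set w := \sum_(i <- l) i.1 => c0 e0 cI lU w0; apply: contrapT => nF.
pose h x := w^-1 * \sum_(i <- l | i.2 == x) i.1.
have hE x : x \notin [seq i.2 | i <- l] -> h x = 0.
  move=> xl; rewrite /h big_seq_cond big1 ?mulr0// => i /andP[il /eqP ix].
  by move: xl; rewrite -ix map_f.
pose K := [fset x in [seq i.2 | i <- l]]%fset.
have bracketE (f : X -> R) : bracket f h = w^-1 * \sum_(i <- l) i.1 * f i.2.
  rewrite /bracket (fsbigTE K); last first.
    by move=> x; rewrite !inE /= => /hE ->; rewrite mulr0.
  rewrite mulr_sumr (eq_bigr (fun x =>
    \sum_(i <- l | i.2 == x) w^-1 * (i.1 * f i.2))); last first.
    move=> x _; rewrite mulrCA mulr_sumr mulr_sumr; apply: eq_bigr => i /eqP ->.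
    by rewrite [f x * _]mulrC.
  rewrite (exchange_big_dep xpredT)//= [LHS]big_seq [RHS]big_seq.
  apply: eq_bigr => i il; under eq_bigl do rewrite eq_sym.
  rewrite -big_filter filter_pred1_uniq ?fset_uniq ?big_seq1//.
  by rewrite !inE /= map_f.
have hDelta : Delta U h.
  split.
  - move=> x; rewrite /h mulr_ge0 ?invr_ge0 ?(ltW w0)//.
    by rewrite big_seq_cond sumr_ge0// => i /andP[/lU[]].
  - apply: (@sub_finite_set _ _ [set` [seq i.2 | i <- l]]); last exact: finite_seq.
    by move=> x /=; apply: contraNT => /hE ->.
  - move=> x /= hx; have : x \in [seq i.2 | i <- l].
      by apply: contraNT hx => /hE ->.
    by move=> /mapP[i /lU[_ Ui] ->].
  - transitivity (bracket (fun=> 1) h).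
      by rewrite /bracket; apply: eq_fsbigr => x _; rewrite mul1r.
    rewrite bracketE (eq_bigr (fun i => i.1)); last by move=> i _; rewrite mulr1.
    by rewrite -/w mulVf// gt_eqF.
(* [nnsup] counts 0 among the values, whence the maximum with 0; it still lies below [c], as [c] and
   [e] are positive. *)
have : (c%:E <= (Num.max 0 (c - e))%:E)%E.
  apply: le_trans cI _; apply: le_trans (ereal_inf_lbound _) _.
    by exists h; [exact: hDelta|reflexivity].
  apply/nnsup_leP; split=> [|_ [f Ff <-]]; first by rewrite lee_fin le_max lexx.
  rewrite minE// bracketE lee_fin le_max; apply/orP; right.
  by rewrite ler_pdivrMl// [w * _]mulrC leNgt; apply/negP => H; apply: nF; exists f.
by rewrite lee_fin le_max !leNgt c0 ltrBlDr ltrDl e0.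
Qed.

Lemma Int_of_I_gt0 (U : set X) : [set: X] !=set0 -> F !=set0 ->
  (0 < I_of F U)%E ->
  exists2 g, Int F g & exists2 c, 0 < c & forall x, U x -> c <= g x.
Proof.
move=> [x0 _] [f0 Ff0] I0.
(* When [I_of F U] is infinite any positive constant would do, and 1 is taken. *)
have [c c0 cI] : exists2 c : R, 0 < c & (c%:E <= I_of F U)%E.
  case: (I_of F U) I0 => [r|_|//]; last by exists 1 => //; rewrite leey.
  by rewrite lte_fin; exists r.
(* A conic combination of the shifted evaluations is [[f, h] - c |h|], so the infimum formed in
   [linear_minorant_ge0] becomes [inf_h (sup_f (phi f + [f, h]) - c |h|)]. *)
pose ev x : set_type F -> R := fun w => val w x - c.
pose W := [set ev x | x in U].
(* Picks a point of [U] behind each member of [W]; [x0] is a default value off [W]. *)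
pose pt phi := if pselect (W phi) is left h then sval (cid2 h) else x0.
have ptP phi : W phi -> U (pt phi) /\ ev (pt phi) = phi.
  by rewrite /pt; case: pselect => // h _; case: cid2.
have t0 : set_type F := SigSub (mem_set Ff0).
have evB x : ev x \in @bounded_functions R (set_type F).
  apply/bounded_functionsP; exists (1 + `|c|) => w.
  rewrite (le_trans (ler_normB _ _))// lerD2r.
  by have /andP[? ?] := F01 (set_valP w) x; rewrite ger0_norm.
have [||L [LD LZ LM LW]] := positive_functional t0 (W := W).
- by move=> _ [x _ <-]; exact: evB.
- move=> l lW e e0; pose w := \sum_(i <- l) i.1.
  have w0 : 0 <= w.
    by rewrite /w big_seq sumr_ge0// => i /lW[].
  have sumE t : \sum_(i <- l) i.1 * i.2 t =
      \sum_(i <- [seq (i.1, pt i.2) | i <- l]) i.1 * val t i.2 - c * w.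
    rewrite big_map/= mulr_sumr -sumrB big_seq [RHS]big_seq.
    apply: eq_bigr => i /lW[_ /ptP[_ iE]].
    have -> : i.2 t = ev (pt i.2) t by rewrite iE.
    by rewrite /ev mulrBr [c * _]mulrC.
  move: w0; rewrite le_eqVlt => /predU1P[w0|w0].
    (* With total weight 0 all weights vanish, and the combination is 0, above [- e]. *)
    exists t0; rewrite big_seq big1 ?oppr_lt0// => i il.
    suff -> : i.1 = 0 by rewrite mul0r.
    apply/eqP; rewrite eq_le (lW _ il).1 andbT w0 /w (big_rem _ il)/= lerDl.
    by rewrite big_seq sumr_ge0// => j /mem_rem/lW[].
  have wE : \sum_(i <- [seq (i.1, pt i.2) | i <- l]) i.1 = w by rewrite big_map.
  (* The slack gets multiplied by the total weight [w], hence the choice [e / w]. *)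
  have [|||f Ff] := @I_of_le_conic U c (e / w) [seq (i.1, pt i.2) | i <- l] c0 _ cI.
  + exact: divr_gt0.
  + by move=> i /mapP[j /lW[j0 /ptP[Uj _]] ->].
  + by rewrite wE.
  + rewrite wE mulrBl divfK ?gt_eqF// => H; exists (SigSub (mem_set Ff)).
    by rewrite sumE ltrBrDr addrC.
have [m m_prob mL] := finadd_of_functional LD LZ LM.
(* Adding [c] back undoes the shift, since constants integrate to themselves. *)
exists (fun x => L (ev x) + c).
  exists m; split=> // x; apply/(DS_integralP m_prob).
  rewrite (_ : (fun w => _) = (fun w => ev x w + c)).
    by apply: DS_epsD => //; [exact: mL|exact: DS_eps_cst].
  by apply/funext => w; rewrite /ev subrK.
by exists c => // x Ux; rewrite lerDr; apply: LW; exists x.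
Qed.

End positivity.

(** * Cardinal arithmetic: an infinite cardinal absorbs a countable factor *)

Definition to_setT (T : Type) (t : T) : [set: T] := SigSub (mem_set (I : [set: T] t)).

Lemma infinite_card_le (T K : Type) : infinite_set [set: K] ->
  ([set: T] #<= [set: K])%card <-> exists f : T -> K, injective f.
Proof.
move=> Kinf; have [k0 _] := infinite_setN0 Kinf.
split=> [/card_leP[f]|[f finj]].
  exists (fun t => val (f (to_setT t))) => s t /val_inj/(inj (f := f)).
  by move=> /(_ _ _)/(congr1 val); apply; rewrite in_setT.
have /injfunPex[g] : exists2 f : T -> K, set_fun setT setT f & set_inj setT f.
  by exists f => // s t _ _; exact: finj.
exact: inj_card_le.
Qed.

(* A maximal family of pairwise disjoint injective sequences in K leaves out
   only finitely many points, so K embeds in (family * nat), and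
   (family * nat) * nat embeds in K. *)
Lemma infinite_card_mul_nat (K : Type) : infinite_set [set: K] ->
  exists f : K * nat -> K, injective f.
Proof.
move=> Kinf.
pose disjoint_family (A : set (nat -> K)) :=
  (forall e, A e -> injective e) /\
  forall e e' n n', A e -> A e' -> e n = e' n' -> e = e'.
have [Ch ChP totCh|A [[Ainj Adisj] Amax]] := @Zorn_bigcup _ disjoint_family.
  split=> [e [C CC Ce]|e e' n n' [C CC Ce] [C' CC' C'e']].
    by case: (ChP _ CC) => + _; apply.
  have [CC'sub|C'Csub] := totCh _ _ CC CC'.
    by case: (ChP _ CC') => _; apply=> //; exact: CC'sub.
  by case: (ChP _ CC) => _; apply=> //; exact: C'Csub.
pose Z := [set k | forall e n, A e -> e n <> k].
(* An infinite [Z] would contain an injective sequence, which could be added to [A]. *)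
have Zfin : finite_set Z.
  apply: contrapT => Zinf.
  have [g gZ ginj] : exists2 g : nat -> K, forall n, Z (g n) & injective g.
    have /infiniteP/card_leP[f] := Zinf.
    exists (fun n => val (f (to_setT n))) => [n|m n /val_inj/(inj (f := f))].
      exact: set_valP.
    by move=> /(_ _ _)/(congr1 val); apply; rewrite in_setT.
  have gA : ~ A g by move=> /(gZ 0%N g 0%N).
  apply: (Amax (A `|` [set g])).
    split; first exact: subsetUl.
    by move=> /(_ g) /(_ (or_intror erefl)).
  split=> [e [/Ainj|->]//|e e' n n' [Ae|->] [Ae'|->]//].
  - exact: Adisj.
  - by move=> /(gZ n' e n Ae).
  - by move=> /esym/(gZ n e' n' Ae').
have [e0 Ae0] : A !=set0.
  apply: contrapT => A0; apply: Kinf; apply: sub_finite_set Zfin => k _ e n Ae.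
  by exfalso; apply: A0; exists e.
have [i iinj] : exists i : K -> nat, forall k l, Z k -> Z l -> i k = i l -> k = l.
  have /countable_injP[i iinj] := finite_set_countable Zfin.
  by exists i => k l Zk Zl; apply: iinj; exact: mem_set.
(* Each [k] gets an address: a member of [A] with a tag, [inl n] if [k] is its term of rank [n], or
   [inr (i k)] if [k] is left over in [Z]. *)
have /choice[j jP] : forall k, exists p : (nat -> K) * (nat + nat),
    A p.1 /\ match p.2 with inl n => p.1 n = k | inr n => Z k /\ n = i k end.
  move=> k; have [Zk|/existsNP[e /existsNP[n /not_implyP[Ae /contrapT enk]]]] :=
    pselect (Z k).
    by exists (e0, inr (i k)).
  by exists (e, inl n).
have jinj k l : j k = j l -> k = l.
  have [_ jk] := jP k; have [_ jl] := jP l => jkl; rewrite -jkl in jl.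
  case: (j k).2 jk jl => n; first by move=> jk; apply: etrans.
  by move=> [Zk nk] [Zl nl]; apply: iinj => //; rewrite -nk.
(* The pair [(k, n)] goes to a term of the sequence in the address of [k], at a rank coding the tag
   together with [n]. Disjointness recovers the sequence, and injectivity the rank. *)
exists (fun p => (j p.1).1 (choice.pickle ((j p.1).2, p.2))) => -[k n] [l m] /= jkl.
have [Ak _] := jP k; have [Al _] := jP l.
have jj := Adisj _ _ _ _ Ak Al jkl.
rewrite jj in jkl; have /(pcan_inj choice.pickleK)[j2 ->] := Ainj _ Al _ _ jkl.
by rewrite (jinj k l)//; case: (j k) (j l) jj j2 => [? ?] [? ?] /= -> ->.
Qed.

Lemma card_le_mul_nat (K T : Type) (G : set T) : infinite_set [set: K] ->
  (G #<= [set: K])%card -> ([set: set_type G * nat] #<= [set: K])%card.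
Proof.
move=> Kinf GK; have [f finj] := infinite_card_mul_nat Kinf.
have /(infinite_card_le _ Kinf)[g ginj] : ([set: set_type G] #<= [set: K])%card.
  by rewrite (card_le_eql (card_setT _)).
apply/(infinite_card_le _ Kinf); exists (fun p => f (g p.1, p.2)).
by move=> [a n] [b m] /finj[/ginj -> ->].
Qed.

(** * Nets, and the two equivalences *)

Lemma tails_filter (D : Type) (le : D -> D -> Prop) : is_directed le ->
  Filter (tails le).
Proof.
move=> [[d0 _] lexx letrans ledir]; split; first by exists d0.
- move=> A B [a Aa] [b Bb]; have [c [ac bc]] := ledir a b.
  by exists c => d cd; split; [apply: Aa|apply: Bb]; exact: letrans cd.
- by move=> A B AB [a Aa]; exists a => d /Aa/AB.
Qed.

Theorem theorem4 (R : realType) (K : Type) (hK : infinite_set [set: K])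
    (X : choiceType) (hX : [set: X] !=set0)
    (F : set (X -> R)) (hF0 : F !=set0)
    (hF : forall f, F f -> forall x, 0 <= f x <= 1) :
  (induces_exhaustion K F <->
     exists G : set (X -> R),
       [/\ G `<=` Int F,
           (G #<= [set: K])%card &
           forall x : X,
             nnsup [set g x | g in G] = 0%E -> nnsup [set f x | f in F] = 0%E])
  /\
  (induces_residual_exhaustion K F <->
     exists G : set (X -> R),
       [/\ G `<=` Int F,
           (G #<= [set: K])%card &
           forall (D : Type) (le : D -> D -> Prop) (x : D -> X),
             is_directed le ->
             (forall g, G g -> g (x d) @[d --> tails le] --> (0 : R)) ->
             (forall f, F f -> f (x d) @[d --> tails le] --> (0 : R))]).
Proof.
(* Serves the direct implications of both (a) and (b), with [G] the range of [g], which is no larger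
   than the index set. *)
have from_exhaustion (A : Type) (Xs : A -> set X) :
    ([set: A] #<= [set: K])%card -> (forall a, (0 < I_of F (Xs a))%E) ->
    exists g : A -> X -> R, [/\ range g `<=` Int F, (range g #<= [set: K])%card &
      forall a, exists2 c, 0 < c & forall x, Xs a x -> c <= g a x].
  move=> AK I0; have /choice[g gP] : forall a, exists g : X -> R, Int F g /\
      exists2 c, 0 < c & forall x, Xs a x -> c <= g x.
    by move=> a; have [g ? ?] := Int_of_I_gt0 hF hX hF0 (I0 a); exists g.
  exists g; split=> [_ [a _ <-]||a]; [by case: (gP a)| |by case: (gP a)].
  exact: card_le_trans (card_image_le _ _) AK.
pose Xs (G : set (X -> R)) (p : set_type G * nat) :=
  [set x | p.2.+1%:R^-1 <= val p.1 x].
have Xs_gt0 (G : set (X -> R)) p : G `<=` Int F -> (0 < I_of F (Xs G p))%E.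
  move=> GF; apply: lt_le_trans (_ : ((p.2.+1%:R^-1)%:E <= _)%E).
    by rewrite lte_fin invr_gt0.
  by apply: (I_of_ge_Int hF (GF _ (set_valP p.1))).
split; split.
- move=> [A [Xa [AK I0 /nnsup_eq0P Xa0]]].
  have [g [gF gK gP]] := from_exhaustion _ _ AK I0.
  exists (range g); split=> // x /nnsup_eq0P gx0; apply/nnsup_eq0P => _ [f Ff <-].
  apply: le_trans (ler_norm _) _; apply: Xa0; exists x; last by exists f.
  (* At a point of [Xa a] the value of [g a] would be at least [c > 0], although every member of the
     range is at most 0 at [x]. *)
  move=> [a _ Xax]; have [c c0 /(_ x Xax) cg] := gP a.
  have : g a x <= 0 by apply: gx0; exists (g a) => //; exists a.
  by apply/negP; rewrite -ltNge (lt_le_trans c0).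
- move=> [G [GF GK G0]]; exists (set_type G * nat)%type, (Xs G).
  split; [exact: card_le_mul_nat|by move=> p; exact: Xs_gt0|].
  apply/nnsup_eq0P => _ [x nXx [f Ff <-]].
  have /G0/nnsup_eq0P f0 : nnsup [set g x | g in G] = 0%E.
    (* If [g x > 0], some [n] has [1/(n+1) < g x], which puts [x] in a level set of [g]. *)
    apply/nnsup_eq0P => _ [g Gg <-]; rewrite leNgt; apply/negP => gx0.
    have [n _ /(_ n (leqnn _)) ng] := near_infty_natSinv_lt (PosNum gx0).
    by apply: nXx; exists (SigSub (mem_set Gg), n) => //; exact: ltW.
  rewrite ger0_norm; first by apply: f0; exists f.
  by case/andP: (hF f Ff x).
- move=> [A [Xa [AK I0 Xa0]]].
  have [g [gF gK gP]] := from_exhaustion _ _ AK I0.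
  exists (range g); split=> // D le x Ddir gx0 f Ff; apply: Xa0 => // n al.
  have Ft := tails_filter Ddir.
  suff : \forall d \near tails le, forall i, ~ Xa (al i) (x d).
    by apply: filterS => d dX i _; exact: dX.
  (* Only finitely many indices occur, so each may be treated alone: [g (al i)] tends to 0 along the
     net and so falls below its lower bound [c] on [Xa (al i)]. *)
  apply: filter_forall => i; have [c c0 cg] := gP (al i).
  have /cvgr0Pnorm_lt/(_ _ c0) : g (al i) (x d) @[d --> tails le] --> (0 : R).
    by apply: gx0; exists (al i).
  apply: filterS => d dc /cg; apply/negP; rewrite -ltNge.
  exact: le_lt_trans (ler_norm _) dc.
- move=> [G [GF GK G0]]; exists (set_type G * nat)%type, (Xs G).
  split; [exact: card_le_mul_nat|by move=> p; exact: Xs_gt0|].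
  move=> D le x Ddir xX; apply: G0 => // g Gg; have Ft := tails_filter Ddir.
  apply/cvgr0Pnorm_lt => e e0.
  have [n _ /(_ n (leqnn _)) ne] := near_infty_natSinv_lt (PosNum e0).
  (* Applied to a single index: being eventually outside the level set means [g < 1/(n+1) < e]
     eventually. *)
  have := xX 1%N (fun=> (SigSub (mem_set Gg), n)); apply: filterS => d /(_ ord0 I).
  rewrite /Xs /= => /negP; rewrite -ltNge => gn.
  (* Non-negativity of the integral turns the upper bound on [g] into one on its absolute value. *)
  have g0 : 0 <= g (x d).
    have [m [m_prob /(_ (x d))]] := GF _ Gg.
    move=> /(DS_integralP m_prob)/(DS_eps_ge0 m_prob); apply => w.
    by case/andP: (hF _ (set_valP w) (x d)).
  by rewrite ger0_norm// (lt_trans gn).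
Qed.
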